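(* The interacting particle system is non-explosive: for every $f\in F_0(G)$, $$P_f\Big(\sum_{n=1}^\infty\xi_n=\infty\Big)=1 .$$
   Context: A graph is a quadruple $G=(V,E,K,m)$: $V$ is a finite or countable set of nodes, which are elements of a real Hilbert space $\mathcal H$ with inner product ''$\cdot$'' and norm $|\cdot|$; $E$ is a set of undirected edges (at most one edge between any two distinct nodes, no self-loops); the edge between $x$ and $y$ is written $\langle x,y\rangle=\langle y,x\rangle$, and $y\sim x$ means this edge exists; $K=(k_{xy})_{x,y\in V}$ with $k_{xy}=k_{yx}\ge0$ and $k_{xy}=0$ if there is no edge; $m=(m_x)_{x\in V}$ with $m_x>0$. Let $e_{xy}=(y-x)/|y-x|$. Assume $d_0=\sup_{x\in V}\#\{y:y\sim x\}<\infty$, set $d=\max\{d_0,2\}$, and assume $M=\max\{\sup_{x\in V}m_x^{-1},\sup_{\langle x,y\rangle\in E}k_{xy}\}<\infty$. $V=V_0\cup V_1$ is a fixed partition into disjoint sets. $F(G)$ is the set of functions $f$ assigning a real number $f(x)$ to each $x\in V$ and a vector $f(\langle x,y\rangle)\in\mathcal H$ that is a real multiple of $y-x$ to each edge. For $1\le\alpha<\infty$, $\|f\|_\alpha=\big(\sum_{x\in V}|f(x)|^\alpha/m_x+\sum_{\langle x,y\rangle\in E}k_{xy}|f(\langle x,y\rangle)|^\alpha\big)^{1/\alpha}$, and $\|f\|_\infty=\max\{\sup_x|f(x)|,\sup_{\langle x,y\rangle}|f(\langle x,y\rangle)|\}$. $F_0(G)$ is the set of $f\in F(G)$ with finitely many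 nonzero values such that $|f(x)|\in\mathbb Z$ and $|f(\langle x,y\rangle)|\in\mathbb Z$ for all nodes and edges. The interacting particle system (IPS) $(f_t)_{t\ge0}$ is the continuous-time Markov jump process on $F_0(G)$ with the following transitions from state $f$: (i) for each $x\in V$, at rate $|f(x)|/m_x$, for every $y\sim x$ the edge value $f(\langle x,y\rangle)$ is replaced by $f(\langle x,y\rangle)+\mathrm{sgn}(f(x))\,e_{yx}$ (all other values unchanged); (ii) for each edge $\langle x,y\rangle$, at rate $k_{xy}|f(\langle x,y\rangle)|$, with $s=\mathrm{sgn}(f(\langle x,y\rangle)\cdot e_{xy})$, the value $f(x)$ is replaced by $f(x)+s$ if $x\in V_0$ and $f(y)$ by $f(y)-s$ if $y\in V_0$ (values at nodes of $V_1$ never change; this rule is symmetric in $x,y$). $P_f,\mathbb E_f$ denote probability and expectation given $f_0=f$. $\tau_0=0$, $\tau_n$ is the time of the $n$-th jump, $\xi_n=\tau_n-\tau_{n-1}$, $h_n=f_{\tau_n}$, and $\eta_t=\sup\{n:\tau_n\le t\}$. *)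

(* Defs.v *)
From HB Require Import structures.
From mathcomp Require Import all_boot all_order all_algebra.
From mathcomp Require Import all_classical all_reals all_analysis.
From mathcomp Require Import measurable_realfun.
Set Implicit Arguments. Unset Strict Implicit. Unset Printing Implicit Defensive.
Import Order.TTheory GRing.Theory Num.Theory.
Local Open Scope classical_set_scope.
Local Open Scope ring_scope.

(* Graph encoding.  The node set V is a countable type (distinct nodes are
   distinct points of the Hilbert space H).  Every edge <x,y> of E is listed
   exactly once, as an ordered pair (a,b) with [E a b] true; this fixes the
   orientation e_{ab} = (b-a)/|b-a| of the edge.  Since f(<a,b>) is a real
   multiple of b - a with |f(<a,b>)| an integer, f(<a,b>) = z * e_{ab} for a
   unique z : int; a state of F_0(G) is thus encoded by
     f.1 : V -> int       (node values f(x))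
     f.2 : V * V -> int   (edge values: f(<a,b>) = f.2 (a,b) * e_{ab}). *)
Definition state (V : countType) : Type := ((V -> int) * (V * V -> int))%type.

Definition adj (V : countType) (E : rel V) (x y : V) : bool := E x y || E y x.

Definition F0 (V : countType) (E : rel V) (f : state V) : Prop :=
  [/\ finite_set [set x | f.1 x != 0],
      finite_set [set e : V * V | f.2 e != 0]
    & forall e : V * V, ~~ E e.1 e.2 -> f.2 e = 0].

(* transition (i) at node x: for every y ~ x, f(<x,y>) += sgn(f(x)) e_{yx}.
   For the stored orientation (a,b): e_{yx} = -e_{ab} if x = a, and
   e_{yx} = e_{ab} if x = b. *)
Definition node_step (V : countType) (E : rel V) (f : state V) (x : V) : state V :=
  (f.1, fun e : V * V => if E e.1 e.2
          then f.2 e + sgz (f.1 x) * ((e.2 == x)%:Z - (e.1 == x)%:Z)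
          else f.2 e).

(* transition (ii) at edge (a,b): s = sgn(f(<a,b>) . e_{ab}) = sgn(f.2 (a,b));
   f(a) += s if a \in V0, f(b) -= s if b \in V0. *)
Definition edge_step (V : countType) (V0 : pred V) (f : state V) (e : V * V) : state V :=
  (fun z => if (z == e.1) && V0 e.1 then f.1 z + sgz (f.2 e)
            else if (z == e.2) && V0 e.2 then f.1 z - sgz (f.2 e)
            else f.1 z, f.2).

Definition node_rate (R : realType) (V : countType) (m : V -> R) (f : state V) (x : V) : R :=
  (`|f.1 x|%:~R) / m x.

Definition edge_rate (R : realType) (V : countType) (k : V -> V -> R) (f : state V) (e : V * V) : R :=
  k e.1 e.2 * `|f.2 e|%:~R.

Definition qrate (R : realType) (V : countType) (E : rel V) (V0 : pred V)
  (m : V -> R) (k : V -> V -> R) (f g : state V) : \bar R :=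
  if `[< g = f >] then 0%E else
  (\esum_(x in [set x | node_step E f x = g]) (node_rate m f x)%:E
   + \esum_(e in [set e : V * V | E e.1 e.2 /\ edge_step V0 f e = g]) (edge_rate k f e)%:E)%E.

(* total jump rate q(f) = sum over g <> f of q(f,g) *)
Definition qtot (R : realType) (V : countType) (E : rel V) (V0 : pred V)
  (m : V -> R) (k : V -> V -> R) (f : state V) : \bar R :=
  (\esum_(x in [set x | node_step E f x <> f]) (node_rate m f x)%:E
   + \esum_(e in [set e : V * V | E e.1 e.2 /\ edge_step V0 f e <> f]) (edge_rate k f e)%:E)%E.

Definition jump_prob (R : realType) (V : countType) (E : rel V) (V0 : pred V)
  (m : V -> R) (k : V -> V -> R) (f g : state V) : R :=
  if 0 < fine (qtot E V0 m k f)
  then fine (qrate E V0 m k f g) / fine (qtot E V0 m k f)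
  else (if `[< f = g >] then 1 else 0).

(* (h_n)_{n>=0}, (xi_n)_{n>=1} on the probability space (Omega, P) are the
   jump chain h_n = f_{tau_n} and the holding times xi_n = tau_n - tau_{n-1}
   (values in [0, +oo]) of the IPS started at f0: h_0 = f0 and for every n,
   states g_1..g_n and times t_1..t_n >= 0,
   P(h_i = g_i, xi_i > t_i, 1<=i<=n)
     = prod_{i=1}^n p(g_{i-1},g_i) exp(-q(g_{i-1}) t_i),   g_0 = f0.
   (xi 0 is unused.) *)
Definition IPS_jump_process (R : realType) (d : measure_display)
  (Omega : measurableType d) (P : probability Omega R)
  (V : countType) (E : rel V) (V0 : pred V) (m : V -> R) (k : V -> V -> R)
  (f0 : state V) (h : nat -> Omega -> state V) (xi : nat -> Omega -> \bar R) : Prop :=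
  [/\ forall w, h 0%N w = f0,
      forall n g, measurable [set w | h n w = g],
      forall n, measurable_fun [set: Omega] (xi n : Omega -> \bar R)
    & forall (n : nat) (gs : nat -> state V) (ts : nat -> R),
        gs 0%N = f0 -> (forall i, 0 <= ts i) ->
        P [set w | forall i, (i < n)%N -> h i.+1 w = gs i.+1 /\ ((ts i)%:E < xi i.+1 w)%E]
        = (\prod_(i < n) (jump_prob E V0 m k (gs i) (gs i.+1)
                          * expR (- fine (qtot E V0 m k (gs i)) * ts i)))%:E].

(* Main.v *)
Require Import Defs.
From HB Require Import structures.
From mathcomp Require Import all_boot all_order all_algebra.
From mathcomp Require Import finmap.
From mathcomp Require Import all_classical all_reals all_analysis.
From mathcomp Require Import measurable_realfun ring zify.
Set Implicit Arguments. Unset Strict Implicit. Unset Printing Implicit Defensive.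
Import Order.TTheory GRing.Theory Num.Theory.
Local Open Scope classical_set_scope.
Local Open Scope ring_scope.

(** The mass [\sum_x |f x| + \sum_e |f e|] grows by at most a constant at each
    jump, and the total jump rate is at most [M] times the mass; hence the rate
    after [n] jumps is at most [C (n + 1)].  With [t_i = 1 / (i + 1)], given the
    jump chain each holding time exceeds [t_i] with probability at least
    [c = expR (- C)].  On the event that the holding times are positive,
    [expR (- \sum_(i < n) xi_i)] is at most the product over [i < n] of
    [expR (- t_i)] if [xi_i > t_i] and [1] otherwise, whose expectation is at most
    [\prod_(i < n) (1 - (1 - expR (- t_i)) c)].  This tends to [0] because the
    harmonic series diverges, so Markov's inequality shows that the holding times
    almost surely have an infinite sum. *)

(** * Jump processes with linearly growing rates *)

(** By [1 - x <= expR (- x)] the product is at most [expR (- (c * u n))], where [u n] is a harmonic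
    sum without its first term. *)
Lemma prod_one_sub_harmonic_small (R : realType) (c e : R) (a : nat -> R) :
  0 < c -> 0 < e -> (forall i, i.+2%:R^-1 <= a i) -> (forall i, a i * c <= 1) ->
  exists n, \prod_(i < n) (1 - a i * c) < e.
Proof.
move=> c0 e0 age acle.
pose u n : R := \sum_(i < n) i.+2%:R^-1.
have prod_le n : \prod_(i < n) (1 - a i * c) <= expR (- (c * u n)).
  rewrite /u mulr_sumr -sumrN expR_sum; apply: ler_prod => i _.
  rewrite subr_ge0 acle /=; apply: (le_trans _ (expR_ge1Dx _)).
  by rewrite lerD2l lerN2 mulrC ler_wpM2r// ltW.
have [n un] : exists n, - ln e / c < u n.
  have nd : nondecreasing_seq (series (@harmonic R)).
    apply/nondecreasing_seqP => n; rewrite seriesSr lerDl.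
    by rewrite invr_ge0.
  have := nondecreasing_dvgn_lt nd (@dvg_harmonic R).
  (* The extra [1] accounts for the first harmonic term, which [u] omits. *)
  move=> /cvgryPgt /(_ (- ln e / c + 1)) [N _ /(_ N.+1 (leqnSn N)) /=].
  rewrite seriesEnat /= big_mkord big_ord_recl /= invr1 addrC ltrD2l.
  by exists N.
exists n; apply: (le_lt_trans (prod_le n)).
by rewrite -[ltRHS]lnK// ltr_expR ltrNl mulrC -ltr_pdivrMr.
Qed.

(* The series need not converge; its junk value [point] is [0], hence the set is
   the convergence set to [+oo]. *)
Lemma measurable_eseries_eq_pinfty (R : realType) (d : measure_display)
    (T : measurableType d) (u : nat -> T -> \bar R) :
  (forall n, measurable_fun [set: T] (u n)) ->
  measurable [set w | (\sum_(0 <= n <oo) u n w)%E = +oo%E].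
Proof.
move=> mu; rewrite (_ : [set w | _] = \bigcap_k \bigcup_N
    \bigcap_(n in [set n | (N <= n)%N]) [set w | (k%:R%:E < \sum_(0 <= i < n) u i w)%E]); last first.
  apply/seteqP; split=> w /=.
    move=> lim_pinfty k _.
    have /cvgeyPgt/(_ k%:R)[N _ hN] :
        (fun n => \sum_(0 <= i < n) u i w)%E @ \oo --> (+oo%E : \bar R).
      rewrite -lim_pinfty; apply: contrapT => /dvgP lim0.
      by have := lim_pinfty; rewrite lim0.
    by exists N.
  move=> gtk; apply/cvg_lim => //; apply/cvgeyPgt => A.
  have [N _ hN] := gtk (Num.bound `|A|) Logic.I; exists N => // n /hN /=.
  by apply: lt_trans; rewrite lte_fin (le_lt_trans (ler_norm A))// archi_boundP.
apply: bigcapT_measurable => k; apply: bigcupT_measurable => N.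
apply: bigcap_measurable => [|n _]; first by exists N => /=.
rewrite -[X in measurable X]setTI; apply: emeasurable_fun_o_infty => //.
by apply: emeasurable_sum => i; exact: mu.
Qed.

(** * Cylinder events and the expected weight along a fixed path *)

Section JumpProcess.
Import numFieldNormedType.Exports.
Variables (R : realType) (d : measure_display) (Omega : measurableType d).
Variables (P : probability Omega R) (S : choiceType).
Variables (q : S -> R) (p : S -> S -> R) (f0 : S).
Variables (h : nat -> Omega -> S) (xi : nat -> Omega -> \bar R).

Definition cylinder n (gs : nat -> S) (ts : nat -> R) : set Omega :=
  [set w | forall i, (i < n)%N ->
     h i.+1 w = gs i.+1 /\ ((ts i)%:E < xi i.+1 w)%E].

Definition exceed (t : nat -> R) i : set Omega :=
  [set w | ((t i)%:E < xi i.+1 w)%E].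

(* A step-function majorant of [expR (- \sum_(i < n) xi i.+1)]: its expectation
   on cylinders only involves the tails [P (xi > t)]. *)
Definition weight (t : nat -> R) n (w : Omega) : R :=
  \prod_(i < n) (1 - (1 - expR (- t i)) * \1_(exceed t i) w).

Hypothesis measurable_state : forall n g, measurable [set w | h n w = g].
Hypothesis measurable_xi : forall n, measurable_fun [set: Omega] (xi n).
Hypothesis cylinder_law : forall n gs ts, gs 0%N = f0 -> (forall i, 0 <= ts i) ->
  P (cylinder n gs ts) =
  (\prod_(i < n) (p (gs i) (gs i.+1) * expR (- q (gs i) * ts i)))%:E.

Lemma measurable_exceed t i : measurable (exceed t i).
Proof.
rewrite -[exceed t i]setTI.
exact: emeasurable_fun_o_infty measurableT (@measurable_xi i.+1) _.
Qed.

Lemma measurable_cylinder n gs ts : measurable (cylinder n gs ts).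
Proof.
rewrite (_ : cylinder n gs ts =
  \bigcap_(i in `I_n) ([set w | h i.+1 w = gs i.+1] `&` exceed ts i)) //.
by apply: fin_bigcap_measurable => // i _; apply: measurableI;
  [exact: measurable_state|exact: measurable_exceed].
Qed.

Lemma weight_factor_itv (t : nat -> R) i w : 0 <= t i ->
  0 <= 1 - (1 - expR (- t i)) * \1_(exceed t i) w <= 1.
Proof.
move=> ti; rewrite indicE; case: (_ \in _) => /=;
  rewrite ?mulr1 ?mulr0 ?subr0 ?lexx ?ler01 //.
by rewrite opprB addrC subrK expR_ge0 -expR0 ler_expR oppr_le0 ti.
Qed.

Lemma weight_itv t n w : (forall i, 0 <= t i) -> 0 <= weight t n w <= 1.
Proof.
move=> t0; apply/andP; split.
  by apply: prodr_ge0 => i _; case/andP: (weight_factor_itv w (t0 i)).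
by apply: prodr_ile1 => i _; exact: weight_factor_itv.
Qed.

Lemma measurable_weight t n (D : set Omega) :
  measurable D -> measurable_fun D (weight t n).
Proof.
move=> mD; apply: measurable_prod => i _; apply: measurable_funB => //.
by apply: measurable_funM => //; apply: measurable_indic; exact: measurable_exceed.
Qed.

Lemma unit_itv_integrable (D : set Omega) (f : Omega -> R) : measurable D ->
  measurable_fun D f -> (forall w, 0 <= f w <= 1) -> P.-integrable D (EFin \o f).
Proof.
move=> mD mf f01; apply: measurable_bounded_integrable => //.
  by rewrite (le_lt_trans (probability_le1 P mD))// ltry.
exists 1; split => // x x1 w _ /=.
by case/andP: (f01 w) => a b; rewrite ger0_norm// (le_trans b)// ltW.
Qed.

(** Given the jump chain, the holding times are independent exponentials, so the weight integrates
    factor by factor, each indicator giving way to its conditional probability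
    [expR (- q (gs i) * t i)]. *)
Lemma Rintegral_weight t n gs : gs 0%N = f0 -> (forall i, 0 <= t i) ->
  \int[P]_(w in cylinder n gs (fun=> 0)) weight t n w =
  \prod_(i < n) (p (gs i) (gs i.+1) *
                 (1 - (1 - expR (- t i)) * expR (- q (gs i) * t i))).
Proof.
move=> gs0 t0.
(* One holding time at a time: [weight t j.+1] on a cylinder is a difference of
   [weight t j] on that cylinder and on the one with threshold [t j] at [j]. *)
suff H j ts : (j <= n)%N -> (forall i, 0 <= ts i) ->
    (forall i, (i < j)%N -> ts i = 0) ->
    \int[P]_(w in cylinder n gs ts) weight t j w =
    \prod_(i < n) (p (gs i) (gs i.+1) * if (i < j)%N then
        1 - (1 - expR (- t i)) * expR (- q (gs i) * t i)
      else expR (- q (gs i) * ts i)).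
  by rewrite H//; apply: eq_bigr => i _; rewrite ltn_ord.
elim: j ts => [|j IH] ts jn ts0 tsj.
  rewrite (@eq_Rintegral _ _ _ P _ (fun=> 1) _ (fun w _ => big_ord0 _ _ _ _)).
  rewrite Rintegral_cst; last first.
    exact: measurable_cylinder.
  by rewrite mul1r -[RHS]/(fine (_)%:E) -(cylinder_law n gs0 ts0).
pose ts' i := if i == j then t j else ts i.
(* Since [ts j = 0 <= t j], raising the threshold at [j] to [t j] amounts to intersecting with
   [exceed t j]. *)
have cylI : cylinder n gs ts' = cylinder n gs ts `&` exceed t j.
  apply/seteqP; split=> [w hw|w [hw hx] i ltin].
    split; last by have [_] := hw j jn; rewrite /ts' eqxx.
    move=> i ltin; have [-> ] := hw i ltin; rewrite /ts'; split=> //.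
    move: b; case: eqP => [->|//]; rewrite tsj//.
    by apply: le_lt_trans; rewrite lee_fin.
  by have [-> ?] := hw i ltin; rewrite /ts'; case: eqP => [->|].
have mC := measurable_cylinder n gs ts.
have mY := measurable_exceed t j.
have WS w : weight t j.+1 w =
    weight t j w - (1 - expR (- t j)) * (weight t j w * \1_(exceed t j) w).
  rewrite /weight big_ord_recr /=; set a := \prod_(i < j) _; set b := \1__ w.
  by rewrite mulrBr mulr1 mulrCA.
have WI w : weight t j w * \1_(exceed t j) w =
    (weight t j \_ (exceed t j)) w.
  by rewrite patchE indicE; case: ifP; rewrite ?mulr1 ?mulr0.
have iWI : P.-integrable (cylinder n gs ts)
    (EFin \o (fun w => weight t j w * \1_(exceed t j) w)).
  apply: unit_itv_integrable => // [|w].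
    by apply: measurable_funM; [exact: measurable_weight|exact: measurable_indic].
  rewrite WI patchE; case: ifP => _; last by rewrite lexx ler01.
  exact: weight_itv.
have iW : P.-integrable (cylinder n gs ts) (EFin \o weight t j).
  apply: unit_itv_integrable => // [|w]; first exact: measurable_weight.
  exact: weight_itv.
rewrite (eq_Rintegral _ (fun w _ => WS w)) RintegralB//; last first.
  by apply: eq_integrable (integrableZl mC (1 - expR (- t j)) iWI).
rewrite RintegralZl// (eq_Rintegral _ (fun w _ => WI w)) -Rintegral_mkcondr -cylI.
have ts'0 i : 0 <= ts' i by rewrite /ts'; case: eqP.
rewrite !IH//; last 4 first.
- exact: ltnW.
- by move=> i ij; rewrite /ts' ltn_eqF// tsj// ltnS ltnW.
- exact: ltnW.
- by move=> i ij; rewrite tsj// ltnS ltnW.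
pose J := Ordinal jn.
(* The two products differ only at index [j], where the exponentials are [1] and
   [expR (- q (gs j) * t j)]; combining them yields the new factor. *)
rewrite (bigD1 J)//= [X in _ - _ * X](bigD1 J)//= [RHS](bigD1 J)//=.
rewrite ltnn ltnSn /ts' eqxx tsj// mulr0 expR0 mulr1.
rewrite [X in _ - _ * (_ * X) = _](_ : _ = \prod_(i < n | i != J) (p (gs i) (gs i.+1) *
   (if (i < j)%N then 1 - (1 - expR (- t i)) * expR (- q (gs i) * t i)
    else expR (- q (gs i) * ts i)))); last first.
  by apply: eq_bigr => i iJ; rewrite (negPf (iJ : (i : nat) != j)).
rewrite [X in _ = _ * X](_ : _ = \prod_(i < n | i != J) (p (gs i) (gs i.+1) *
   (if (i < j)%N then 1 - (1 - expR (- t i)) * expR (- q (gs i) * t i)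
    else expR (- q (gs i) * ts i)))); last first.
  by apply: eq_bigr => i iJ; rewrite ltnS leq_eqVlt (negPf (iJ : (i : nat) != j)).
set X := \prod_(i < n | _) _; ring.
Qed.

(** Factor by factor, [expR (- xi)] is at most [expR (- t i)] if the holding time exceeds [t i], and
    at most [1] otherwise because it is positive. *)
Lemma expR_le_weight t n w (A : R) : (forall i, 0 <= t i) ->
  (forall i, (i < n)%N -> 0 < xi i.+1 w)%E ->
  (\sum_(i < n) xi i.+1 w <= A%:E)%E -> expR (- A) <= weight t n w.
Proof.
move=> t0; elim: n A => [|n IH] A xi0.
  by rewrite big_ord0 lee_fin /weight big_ord0 -expR0 ler_expR oppr_le0.
rewrite big_ord_recr /= /weight big_ord_recr /= -/(weight t n w).
have s0 : (0 <= \sum_(i < n) xi i.+1 w)%E.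
  by apply: sume_ge0 => i _; apply/ltW/xi0; rewrite ltnS ltnW.
have := xi0 n (ltnSn n); rewrite indicE.
have -> : (w \in exceed t n) = ((t n)%:E < xi n.+1 w)%E.
  by apply/idP/idP; rewrite inE.
(* An infinite holding time contradicts the bound [A]; a finite value [r] leaves the bound [A - r]
   for the first [n] times. *)
case: (xi n.+1 w) => [r| |]//; last first.
  by move=> _; rewrite addey ?leye_eq// -ltNye (lt_le_trans _ s0)// ltNy0.
rewrite !lte_fin => r0; rewrite -leeBrDr// -EFinB => /IH {}IH.
have -> : - A = - (A - r) + - r by ring.
rewrite expRD; apply: ler_pM; rewrite ?expR_ge0 ?IH//.
  by move=> i ltin; apply: xi0; rewrite ltnS ltnW.
case: ltP => tr /=; rewrite ?mulr1 ?mulr0 ?subr0.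
  by rewrite opprB addrC subrK ler_expR lerN2 ltW.
by rewrite -expR0 ler_expR oppr_le0 ltW.
Qed.

Lemma measurable_partial_sum_le n (A : R) :
  measurable [set w | (\sum_(i < n) xi i.+1 w <= A%:E)%E].
Proof.
rewrite -[X in measurable X]setTI; apply: emeasurable_fun_infty_c => //.
by apply: emeasurable_sum => i; exact: measurable_xi.
Qed.

(** This is Markov's inequality: the weight is at least [expR (- A)] on the event, and each factor
    of its integral decreases in [expR (- q (gs i) * t i)], so the lower bound [c] may be
    substituted. *)
Lemma weight_markov t n gs (A c : R) : gs 0%N = f0 -> (forall i, 0 <= t i) ->
  (forall f, 0 <= q f) -> (forall f g, 0 <= p f g) ->
  (forall i, (i < n)%N -> c <= expR (- q (gs i) * t i)) ->
  (P (cylinder n gs (fun=> 0%R) `&` [set w | \sum_(i < n) xi i.+1 w <= A%:E]) <=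
   (expR A * ((\prod_(i < n) p (gs i) (gs i.+1)) *
             \prod_(i < n) (1 - (1 - expR (- t i)) * c)))%:E)%E.
Proof.
move=> gs0 t0 q0 p0 qc.
set C := cylinder _ _ _; set B := [set w | _].
have mC : measurable C by exact: measurable_cylinder.
have mB : measurable B by exact: measurable_partial_sum_le.
have mCB : measurable (C `&` B) by exact: measurableI.
have ub : \int[P]_(w in C) weight t n w <=
    (\prod_(i < n) p (gs i) (gs i.+1)) * \prod_(i < n) (1 - (1 - expR (- t i)) * c).
  rewrite Rintegral_weight// -big_split /=; apply: ler_prod => i _.
  have a0 : 0 <= 1 - expR (- t i) by rewrite subr_ge0 -expR0 ler_expR oppr_le0.
  have a1 : 1 - expR (- t i) <= 1 by rewrite gerBl expR_ge0.
  have e1 : expR (- q (gs i) * t i) <= 1.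
    by rewrite -expR0 ler_expR mulNr oppr_le0 mulr_ge0.
  rewrite mulr_ge0//= ?ler_wpM2l// ?lerD2l ?lerN2 ?ler_wpM2l ?qc//.
  by rewrite subr_ge0 mulr_ile1// expR_ge0.
have mI : measurable_fun C (\1_(C `&` B) : Omega -> R) by exact: measurable_indic.
have iI : P.-integrable C (EFin \o (\1_(C `&` B) : Omega -> R)).
  apply: unit_itv_integrable => // w.
  by rewrite indicE; case: (_ \in _); rewrite ?lexx ler01.
have lb : expR (- A) * fine (P (C `&` B)) <= \int[P]_(w in C) weight t n w.
  have -> : fine (P (C `&` B)) = \int[P]_(w in C) \1_(C `&` B) w.
    by rewrite /Rintegral integral_indic// setIAC setIid.
  rewrite -RintegralZl//; apply: le_Rintegral => //.
  - by apply: eq_integrable (integrableZl mC (expR (- A)) iI).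
  - apply: unit_itv_integrable => // [|w]; first exact: measurable_weight.
    exact: weight_itv.
  - move=> w Cw; rewrite indicE; have [/set_mem[_ Bw]|_] := boolP (_ \in _).
      by rewrite mulr1; apply: expR_le_weight => // i /Cw[].
    by rewrite mulr0; case/andP: (weight_itv n w t0).
rewrite -[leLHS]fineK ?fin_num_measure// lee_fin.
have -> : fine (P (C `&` B)) = expR A * (expR (- A) * fine (P (C `&` B))).
  by rewrite mulrA expRxMexpNx_1 mul1r.
rewrite ler_wpM2l ?expR_ge0//; exact: le_trans lb ub.
Qed.

(** * Summation over the finitely many paths of the jump chain *)

Variables (succ : S -> seq S) (level : nat -> S -> Prop) (C : R).
Hypothesis q_ge0 : forall f, 0 <= q f.
Hypothesis p_ge0 : forall f g, 0 <= p f g.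
Hypothesis level0 : level 0 f0.
Hypothesis levelS : forall n f g, level n f -> g \in succ f -> level n.+1 g.
Hypothesis succ_uniq : forall n f, level n f -> uniq (succ f).
Hypothesis p_sum1 : forall n f, level n f -> \sum_(g <- succ f) p f g = 1.
Hypothesis C_ge0 : 0 <= C.
Hypothesis q_le : forall n f, level n f -> q f <= C * n.+1%:R.

Definition set_at n (g : S) (gs : nat -> S) i := if i == n then g else gs i.

(** Padding with [f0] beyond index [n] makes each finite path a single function, so that distinct
    paths have disjoint cylinders. *)
Fixpoint paths n : seq (nat -> S) :=
  if n isn't n'.+1 then [:: fun=> f0]
  else [seq set_at n'.+1 g gs | gs <- paths n', g <- succ (gs n')].

Lemma pathsP n gs : gs \in paths n ->
  [/\ gs 0%N = f0, forall i, (i <= n)%N -> level i (gs i)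
    & forall i, (n < i)%N -> gs i = f0].
Proof.
elim: n gs => [|n IH] gs /=.
  by rewrite inE => /eqP ->; split=> // i; rewrite leqn0 => /eqP ->.
move=> /allpairsPdep[gs' [g [/IH[gs0 gsl gsf] gsucc ->]]].
split=> [|i|i lti]; rewrite /set_at.
- by [].
- rewrite leq_eqVlt => /predU1P[->|].
    by rewrite eqxx; apply: levelS gsucc; exact: gsl.
  by rewrite ltnS => lein; rewrite ltn_eqF//; exact: gsl.
- by rewrite gtn_eqF// gsf// ltnW.
Qed.

Lemma paths_uniq n : uniq (paths n).
Proof.
elim: n => [//|n IH] /=; apply: allpairs_uniq_dep => //.
  by move=> gs /pathsP[_ /(_ n (leqnn n)) /succ_uniq].
move=> x y /allpairsPdep[gs [g [/pathsP[_ _ gsf] gsucc ->]]].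
move=> /allpairsPdep[gs' [g' [/pathsP[_ _ gsf'] gsucc' ->]]] /= eqgs.
have eqg : g = g'.
  by have := congr1 (fun u => u n.+1) eqgs; rewrite /set_at eqxx.
have eqf : gs = gs'.
  apply/funext => i; have := congr1 (fun u => u i) eqgs; rewrite /set_at.
  by case: eqP => [->|//]; rewrite gsf ?gsf'.
by rewrite eqg eqf.
Qed.

Lemma paths_sum1 n :
  \sum_(gs <- paths n) \prod_(i < n) p (gs i) (gs i.+1) = 1.
Proof.
elim: n => [|n IH] /=; first by rewrite big_seq1 big_ord0.
rewrite big_allpairs_dep /= -[RHS]IH big_seq [RHS]big_seq.
apply: eq_bigr => gs /pathsP[_ gsl _].
have /= := congr1 ( *%R (\prod_(i < n) p (gs i) (gs i.+1)))
  (p_sum1 (gsl n (leqnn n))).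
rewrite mulr1 => <-; rewrite mulr_sumr.
apply: eq_bigr => g _; rewrite big_ord_recr /= /set_at eqxx ltn_eqF//.
congr (_ * _); apply: eq_bigr => i _.
by rewrite !ltn_eqF// ltnS// ltnW.
Qed.

(** The threshold [0] excludes vanishing holding times, as [expR_le_weight] requires. *)
Definition positive_path n : set Omega :=
  \bigcup_(gs in [set` paths n]) cylinder n gs (fun=> 0).

Lemma paths_cylinder_trivIset n (B : set Omega) :
  trivIset [set` paths n] (fun gs => cylinder n gs (fun=> 0) `&` B).
Proof.
move=> gs gs' /= /pathsP[gs0 _ gsf] /pathsP[gs0' _ gsf'] [w [[hw _] [hw' _]]].
apply/funext => i; case: (ltnP n i) => [ni|]; first by rewrite gsf// gsf'.
case: i => [_|i lein]; first by rewrite gs0 gs0'.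
by have [<- _] := hw i lein; have [<- _] := hw' i lein.
Qed.

Lemma probability_positive_path n (B : set Omega) : measurable B ->
  (P (positive_path n `&` B) =
   \sum_(gs <- paths n) P (cylinder n gs (fun=> 0%R) `&` B))%E.
Proof.
move=> mB; rewrite /positive_path setI_bigcupl measure_fin_bigcup//.
- by rewrite -fsbig_seq//; exact: paths_uniq.
- exact: finite_seq.
- exact: paths_cylinder_trivIset.
- by move=> gs _; apply: measurableI => //; exact: measurable_cylinder.
Qed.

Lemma measurable_positive_path n : measurable (positive_path n).
Proof.
apply: fin_bigcup_measurable => [|gs _]; first exact: finite_seq.
exact: measurable_cylinder.
Qed.

(** At threshold [0] the exponential factors are [1], so the cylinder probabilities are the path
    probabilities, which add up to [1]. *)
Lemma positive_path_as n : P (positive_path n) = 1%E.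
Proof.
rewrite -[positive_path n]setIT probability_positive_path//.
rewrite -(paths_sum1 n) -sumEFin big_seq [RHS]big_seq; apply: eq_bigr => gs.
move=> /pathsP[gs0 _ _]; rewrite setIT cylinder_law//; congr EFin.
by apply: eq_bigr => i _; rewrite mulr0 expR0 mulr1.
Qed.

Lemma partial_sum_le_small (A e : R) : 0 < e -> exists n,
  (P (positive_path n `&` [set w | \sum_(i < n) xi i.+1 w <= A%:E]) <= e%:E)%E.
Proof.
move=> e0; pose t i : R := i.+1%:R^-1.
have t0 i : 0 <= t i by rewrite invr_ge0.
pose c := expR (- C).
(* Dividing [e] by [expR A] absorbs the constant of Markov's inequality. *)
have [||i|i|n small] := @prod_one_sub_harmonic_small R c (e / expR A)
    (fun i => 1 - expR (- t i)).
- exact: expR_gt0.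
- by rewrite divr_gt0// expR_gt0.
(* From [expR (- t) <= 1 / (1 + t)] with [t = 1 / (i + 1)], the gap [1 - expR (- t)] is at least
   [1 / (i + 2)]. *)
- have ti : 0 < 1 + t i by rewrite ltr_wpDr.
  have -> : i.+2%:R^-1 = 1 - (1 + t i)^-1 :> R.
    by rewrite /t; field; rewrite nat1r natr1 !pnatr_eq0.
  by rewrite lerD2l lerN2 expRN lef_pV2 ?posrE ?expR_gt0// expR_ge1Dx.
- rewrite mulr_ile1 ?expR_ge0//.
  + by rewrite subr_ge0 -expR0 ler_expR oppr_le0.
  + by rewrite -expR0 ler_expR oppr_le0.
exists n; rewrite probability_positive_path; last exact: measurable_partial_sum_le.
rewrite ltr_pdivlMr ?expR_gt0// mulrC in small.
(* The bound depends on the path only through its probability, because [q (gs i) * t i <= C] on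
   every path. *)
apply: (@le_trans _ _ (\sum_(gs <- paths n) (expR A *
   ((\prod_(i < n) p (gs i) (gs i.+1)) *
    \prod_(i < n) (1 - (1 - expR (- t i)) * c)))%:E)).
  rewrite big_seq [leRHS]big_seq; apply: lee_sum => gs /pathsP[gs0 gsl _].
  apply: weight_markov => // i ltin; rewrite ler_expR mulNr lerN2.
  by rewrite ler_pdivrMr//; apply: q_le; apply: gsl; exact: ltnW.
rewrite sumEFin lee_fin -mulr_sumr -mulr_suml paths_sum1 mul1r; exact: ltW.
Qed.

Theorem linear_rate_nonexplosive :
  P [set w | (\sum_(0 <= n <oo) xi n.+1 w)%E = +oo%E] = 1%E.
Proof.
pose Sn n w := (\sum_(i < n) xi i.+1 w)%E.
pose L n k := positive_path n `&` [set w | (Sn n w <= k%:R%:E)%E].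
(* Integer bounds [k] keep the union countable; each intersection over [n] is null, as it lies in
   events of arbitrarily small probability. *)
pose bad := (\bigcup_n ~` positive_path n) `|` \bigcup_k \bigcap_n L n k.
have mL n k : measurable (L n k).
  by apply: measurableI;
    [exact: measurable_positive_path|exact: measurable_partial_sum_le].
have bad_null : P.-negligible bad.
  apply: negligibleU; apply: negligible_bigcup => k.
    apply/negligibleP; first exact/measurableC/measurable_positive_path.
    transitivity (1 - P (positive_path k))%E.
      exact/probability_setC/measurable_positive_path.
    by rewrite positive_path_as subee.
  have mI : measurable (\bigcap_n L n k) by exact: bigcapT_measurable.
  apply/negligibleP => //; apply/eqP; rewrite eq_le measure_ge0 andbT.
  apply/lee_addgt0Pr => e e0; rewrite add0e.
  have [n] := partial_sum_le_small k%:R e0; apply: le_trans.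
  by apply: le_measure; rewrite ?inE//; [exact: mL|move=> w /(_ n Logic.I)].
set G := [set w | _].
have mG : measurable G.
  by apply: (measurable_eseries_eq_pinfty (fun n => measurable_xi n.+1)).
have : P.-negligible (~` G).
  apply: negligibleS bad_null => w Gw; apply: contrapT => /not_orP[nb1 nb2].
  have pos n : positive_path n w.
    by apply: contrapT => ?; apply: nb1; exists n.
  have xi0 n : (0 < xi n.+1 w)%E.
    by have [gs _ /(_ n (ltnSn n))[]] := pos n.+1.
  (* A total below [r] would bound all partial sums, the terms being positive, and so put [w] in
     every [L n k] for an integer [k] above [r]. *)
  apply: Gw => /=; apply: eq_infty => r; rewrite leNgt; apply/negP => lt_r.
  apply: nb2; exists (Num.bound `|r|) => // n _; split => //=.
  apply: (@le_trans _ _ r%:E); last first.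
    by rewrite lee_fin (le_trans (ler_norm r))// ltW// archi_boundP.
  apply: le_trans (ltW lt_r); rewrite /Sn -(big_mkord xpredT (fun i => xi i.+1 w)).
  by apply: nneseries_lim_ge => i _ _; exact/ltW/xi0.
move=> /(negligibleP _ (measurableC mG)) PGC.
have PG : (1 - P G = 0)%E by rewrite -(probability_setC P mG); exact: PGC.
have PGfin : P G \is a fin_num by rewrite fin_num_measure.
move: PG; rewrite -(fineK PGfin) -EFinB => -[/eqP].
by rewrite subr_eq0 => /eqP <-.
Qed.
End JumpProcess.

(** * Mass, rates and successors of a state *)

Lemma le_esum_scale (R : realType) (T : choiceType) (A : set T) (c : R)
    (a b : T -> \bar R) : 0 <= c -> (forall x, 0 <= a x)%E ->
  (forall x, A x -> b x <= c%:E * a x)%E ->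
  (\esum_(x in A) b x <= c%:E * \esum_(x in [set: T]) a x)%E.
Proof.
move=> c0 a0 ba; apply: ge_ereal_sup => _ [X [finX XA] <-].
apply: (@le_trans _ _ (\sum_(x \in X) (c%:E * a x))%E).
  by apply: lee_fsum => // x /XA; exact: ba.
rewrite -ge0_mule_fsumr//; apply: lee_wpmul2l; rewrite ?lee_fin//.
by apply: ereal_sup_ubound; exists X.
Qed.

(** Several transitions may lead to the same state; each one with nonzero rate that moves [f] is
    counted at exactly one target [g]. *)
Lemma esum_fibers (R : realType) (T S : choiceType) (A : set T) (phi : T -> S)
    (r : T -> \bar R) (f : S) (gl : seq S) :
  (forall x, 0 <= r x)%E -> uniq gl -> f \notin gl ->
  (forall x, A x -> r x != 0%E -> phi x <> f -> phi x \in gl) ->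
  (\sum_(g <- gl) \esum_(x in [set x | A x /\ phi x = g]) r x =
   \esum_(x in [set x | A x /\ phi x <> f]) r x)%E.
Proof.
move=> r0 ugl fgl phigl; rewrite [RHS]esum_mkcond.
under eq_bigr do rewrite esum_mkcond.
rewrite -esum_sum; last by move=> x g _ _; case: ifP.
apply: eq_esum => x _.
have [/set_mem/= [Ax phif]|/negP nA] :=
  boolP (x \in [set x | A x /\ phi x <> f]); last first.
  rewrite big_seq big1// => g ggl; case: ifPn => // /set_mem/= [Ax phig].
  by case: nA; apply/mem_set; split=> // phif; rewrite -phif phig ggl in fgl.
have [rx0|rx0] := eqVneq (r x) 0%E.
  by rewrite rx0 big1// => g _; case: ifP.
have phix := phigl x Ax rx0 phif.
rewrite (bigD1_seq (phi x))//= mem_set//= big1 ?adde0// => g gphi.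
by case: ifPn => // /set_mem/= [_ gE]; rewrite gE eqxx in gphi.
Qed.

(** Nonzero integers contribute at least [1] each, so an infinite support has finite subsets whose
    sums exceed any bound. *)
Lemma esum_int_finite_support (R : realType) (T : choiceType) (a : T -> int) :
  (\esum_(x in [set: T]) (`|a x|%:~R : R)%:E < +oo)%E ->
  finite_set [set x | a x != 0].
Proof.
set s := esum _ _ => s_fin; apply: contrapT => inf.
have s0 : (0 <= s)%E by apply: esum_ge0 => x _; rewrite lee_fin ler0z.
have sfin : s \is a fin_num by rewrite ge0_fin_numE.
have fs0 : 0 <= fine s by exact: fine_ge0.
have [B Bsupp sizeB] := infinite_set_fset (Num.bound (fine s)) inf.
suff : ((fine s)%:E < s)%E by rewrite fineK// ltxx.
pose X : set T := [set` B].
have slb : (\sum_(x \in X) (`|a x|%:~R : R)%:E <= s)%E.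
  by apply: ereal_sup_ubound; exists X => //; split => //; exact: finite_fset.
apply: lt_le_trans slb; rewrite /X.
rewrite fsbig_finite// set_fsetK sumEFin lte_fin.
apply: (lt_le_trans (archi_boundP fs0)).
apply: (@le_trans _ _ (size B)%:R); first by rewrite ler_nat.
rewrite -sum1_size natr_sum big_seq [leRHS]big_seq; apply: ler_sum => x xB.
have := Bsupp x xB; rewrite /= -normr_gt0 => a0.
by rewrite (ler_int R 1) -gtz0_ge1.
Qed.

Lemma finite_support_esum_int (R : realType) (T : choiceType) (a : T -> int) :
  finite_set [set x | a x != 0] ->
  (\esum_(x in [set: T]) (`|a x|%:~R : R)%:E < +oo)%E.
Proof.
move=> fin; rewrite [ltLHS](_ : _ =
  \esum_(x in [set x | a x != 0]) (`|a x|%:~R : R)%:E).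
  rewrite esum_fset//.
  by rewrite fsbig_finite// sumEFin ltry.
rewrite [RHS]esum_mkcond; apply: eq_esum => x _; case: ifPn => // /negP nx.
have [->|ax] := eqVneq (a x) 0; first by rewrite normr0.
by case: nx; rewrite inE.
Qed.

Lemma esum_eq1 (R : realType) (T : choiceType) (a : T) :
  (\esum_(x in [set: T]) ((x == a)%:R : R)%:E = 1)%E.
Proof.
rewrite -[RHS](@esum_set1 R T a (fun=> 1%E))// [RHS]esum_mkcond.
by apply: eq_esum => x _; rewrite in_set1; case: eqP.
Qed.

Section Mass.
Variables (R : realType) (V : countType) (E : rel V) (V0 : pred V).
Variables (m : V -> R) (k : V -> V -> R).

(** The unweighted l1 norm, finite exactly on the states of finite support. *)
Definition mass (f : state V) : \bar R :=
  (\esum_(x in [set: V]) (`|f.1 x|%:~R)%:E +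
   \esum_(e in [set: V * V]) (`|f.2 e|%:~R)%:E)%E.

Lemma abs_int_ge0 (z : int) : (0 <= (`|z|%:~R : R)%:E)%E.
Proof. by rewrite lee_fin ler0z. Qed.

Definition incident (x : V) (e : V * V) : bool :=
  E e.1 e.2 && ((e.1 == x) || (e.2 == x)).

(** An edge at [x] is determined by its other endpoint, a neighbour of [x], because only one
    orientation of an edge is stored. *)
Lemma esum_incident_le (D : nat) (x : V) :
  (forall x y, E x y -> ~~ E y x) ->
  (forall s : seq V, uniq s -> all (adj E x) s -> (size s <= D)%N) ->
  (\esum_(e in [set: V * V]) ((incident x e)%:R : R)%:E <= D%:R%:E)%E.
Proof.
move=> Eonce deg; apply: ge_ereal_sup => _ [X [finX _] <-].
rewrite fsbig_finite// sumEFin lee_fin -natr_sum ler_nat.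
rewrite (eq_bigr (fun e => if incident x e then 1 else 0)%N); last first.
  by move=> e _; case: ifP.
rewrite -big_mkcond sum1_count -size_filter.
pose other (e : V * V) := if e.1 == x then e.2 else e.1.
rewrite -(size_map other); apply: deg.
  rewrite map_inj_in_uniq ?filter_uniq ?fset_uniq// => -[a b] [a' b'].
  rewrite !mem_filter /incident /other /=.
  move=> /andP[/andP[Eab ab] _] /andP[/andP[Eab' ab'] _].
  move: ab ab'; case: (eqVneq a x) => [ax _|_ /= /eqP bx];
    case: (eqVneq a' x) => [ax' _|_ /= /eqP bx'] eqo; subst => //.
    by case/negP: (Eonce _ _ Eab).
  by case/negP: (Eonce _ _ Eab).
apply/allP => y /mapP[[a b] + ->].
rewrite mem_filter /incident /other /adj /= => /andP[/andP[Eab ab] _].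
by case: (eqVneq a x) ab => [<- _|_ /= /eqP <-]; rewrite Eab ?orbT.
Qed.

(** Only the edges incident to [x] change, each by at most [1]. *)
Lemma mass_node_step (D : nat) (x : V) (f : state V) :
  (forall x y, E x y -> ~~ E y x) ->
  (forall s : seq V, uniq s -> all (adj E x) s -> (size s <= D)%N) ->
  (mass (node_step E f x) <= mass f + D%:R%:E)%E.
Proof.
move=> Eonce deg; rewrite /mass /= -addeA leeD2l//.
apply: le_trans (leeD2l _ (esum_incident_le Eonce deg)).
rewrite -esumD; [|by move=> e _; exact: abs_int_ge0|by move=> e _; rewrite lee_fin].
apply: le_esum => e _; rewrite -EFinD lee_fin.
rewrite -[(incident x e)%:R]/((incident x e)%:Z%:~R) -intrD ler_int /incident.
case: ifP => _ /=; last by rewrite addr0.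
apply: (le_trans (ler_normD _ _)); rewrite lerD2l normrM normr_sgz.
by case: (f.1 x != 0); case: (e.1 == x); case: (e.2 == x).
Qed.

Lemma mass_edge_step (e : V * V) (f : state V) :
  (mass (edge_step V0 f e) <= mass f + 2%:E)%E.
Proof.
rewrite /mass /= addeAC leeD2r//.
(* Writing [2] as the sum of two point masses at the endpoints reduces the claim to a termwise
   comparison. *)
rewrite (_ : 2%:E = 1 + 1)%E // -{1}(esum_eq1 R e.1) -(esum_eq1 R e.2).
rewrite -!esumD; [|by move=> z _; rewrite ?adde_ge0 ?abs_int_ge0 ?lee_fin..].
apply: le_esum => z _; rewrite -!EFinD lee_fin.
rewrite -[(z == e.1)%:R]/((z == e.1)%:Z%:~R) -[(z == e.2)%:R]/((z == e.2)%:Z%:~R).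
rewrite -!intrD ler_int.
have sg1 : `|sgz (f.2 e)| <= 1 by rewrite normr_sgz; case: (_ != _).
have fD : `|f.1 z + sgz (f.2 e)| <= `|f.1 z| + 1.
  by rewrite (le_trans (ler_normD _ _))// lerD2l.
have fB : `|f.1 z - sgz (f.2 e)| <= `|f.1 z| + 1.
  by rewrite (le_trans (ler_normB _ _))// lerD2l.
by case: (z == e.1); case: (V0 e.1); case: (z == e.2); case: (V0 e.2) => /=; lia.
Qed.

(** * Jump rates and one-step transition probabilities *)

Hypothesis m_gt0 : forall x, 0 < m x.
Hypothesis k_ge0 : forall x y, 0 <= k x y.

Lemma node_rate_ge0 f x : 0 <= node_rate m f x.
Proof. by rewrite divr_ge0 ?ler0z// ltW. Qed.

Lemma edge_rate_ge0 f e : 0 <= edge_rate k f e.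
Proof. by rewrite mulr_ge0 ?ler0z. Qed.

Lemma qtot_ge0 f : (0 <= qtot E V0 m k f)%E.
Proof.
by apply: adde_ge0; apply: esum_ge0 => ? _;
  rewrite lee_fin ?node_rate_ge0 ?edge_rate_ge0.
Qed.

Lemma qrate_ge0 f g : (0 <= qrate E V0 m k f g)%E.
Proof.
rewrite /qrate; case: ifP => // _.
by apply: adde_ge0; apply: esum_ge0 => ? _;
  rewrite lee_fin ?node_rate_ge0 ?edge_rate_ge0.
Qed.

Lemma jump_prob_ge0 f g : 0 <= jump_prob E V0 m k f g.
Proof.
rewrite /jump_prob; case: ifP => [q0|_]; last by case: ifP.
by rewrite divr_ge0 ?fine_ge0 ?qrate_ge0 ?qtot_ge0.
Qed.

Lemma qtot_le (M : R) f : 0 <= M -> (forall x, (m x)^-1 <= M) ->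
  (forall x y, E x y -> k x y <= M) -> (qtot E V0 m k f <= M%:E * mass f)%E.
Proof.
move=> M0 mM kM; rewrite /mass ge0_muleDr; last 2 first.
- by apply: esum_ge0 => x _; exact: abs_int_ge0.
- by apply: esum_ge0 => x _; exact: abs_int_ge0.
apply: leeD; apply: le_esum_scale => //; try by move=> ?; exact: abs_int_ge0.
  by move=> x _; rewrite -EFinM lee_fin /node_rate mulrC ler_wpM2r ?ler0z.
by move=> e [Ee _]; rewrite -EFinM lee_fin /edge_rate ler_wpM2r ?ler0z ?kM.
Qed.

(** As [fset_set] is empty on infinite sets, the list is meaningful for finite support; it may
    contain targets of rate [0] but then misses none of positive rate. *)
Definition jump_targets (f : state V) : seq (state V) :=
  [seq g <- undup ([seq node_step E f x | x <- fset_set [set x | f.1 x != 0]] ++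
      [seq edge_step V0 f e | e <- fset_set [set e | f.2 e != 0]]) | g != f].

(** The second case mirrors [jump_prob], which keeps the chain at [f] when the total rate is [0]. *)
Definition successors (f : state V) : seq (state V) :=
  if 0 < fine (qtot E V0 m k f) then jump_targets f else [:: f].

Lemma successors_uniq f : uniq (successors f).
Proof.
by rewrite /successors; case: ifP => // _; rewrite filter_uniq ?undup_uniq.
Qed.

Lemma mass_finite_support f : (mass f < +oo)%E ->
  finite_set [set x | f.1 x != 0] /\ finite_set [set e | f.2 e != 0].
Proof.
move=> mf.
have n0 : (0 <= \esum_(x in [set: V]) (`|f.1 x|%:~R : R)%:E)%E.
  by apply: esum_ge0 => x _; exact: abs_int_ge0.
have e0 : (0 <= \esum_(e in [set: V * V]) (`|f.2 e|%:~R : R)%:E)%E.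
  by apply: esum_ge0 => x _; exact: abs_int_ge0.
split; apply: (@esum_int_finite_support R); apply: le_lt_trans mf.
  by rewrite leeDl.
by rewrite leeDr.
Qed.

Lemma sum_qrate f : (mass f < +oo)%E ->
  (\sum_(g <- jump_targets f) qrate E V0 m k f g = qtot E V0 m k f)%E.
Proof.
move=> /mass_finite_support[finx fine].
have fNt : f \notin jump_targets f by rewrite mem_filter eqxx.
have ut : uniq (jump_targets f) by rewrite filter_uniq ?undup_uniq.
rewrite /qtot -(@esum_fibers _ _ _ [set e | E e.1 e.2]
  (edge_step V0 f) _ f _ _ ut)//; last 2 first.
- by move=> e; rewrite lee_fin edge_rate_ge0.
- move=> e _ re ef; rewrite mem_filter mem_undup mem_cat.
  apply/andP; split; first exact/eqP.
  apply/orP; right; apply: map_f; rewrite in_fset_set// inE /=.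
  by apply: contra_neq re => fe; rewrite /edge_rate fe normr0 mulr0.
rewrite [X in (X + _)%E](_ : _ =
    \esum_(x in [set x | [set: V] x /\ node_step E f x <> f])
      (node_rate m f x)%:E); last first.
  by congr esum; apply/seteqP; split => // x [].
rewrite -(@esum_fibers _ _ _ [set: V] (node_step E f) _ f _ _ ut)//; last 2 first.
- by move=> x; rewrite lee_fin node_rate_ge0.
- move=> x _ rx xf; rewrite mem_filter mem_undup mem_cat.
  apply/andP; split; first exact/eqP.
  apply/orP; left; apply: map_f; rewrite in_fset_set// inE /=.
  by apply: contra_neq rx => fx; rewrite /node_rate fx normr0 mul0r.
rewrite -big_split /= big_seq [RHS]big_seq; apply: eq_bigr => g gt.
rewrite /qrate; case: ifPn => [/asboolP gf|_].
  by rewrite gf (negPf fNt) in gt.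
by congr (_ + _)%E; congr esum; apply/seteqP; split => // x [].
Qed.

Lemma sum_jump_prob f : (mass f < +oo)%E -> (qtot E V0 m k f < +oo)%E ->
  \sum_(g <- successors f) jump_prob E V0 m k f g = 1.
Proof.
move=> mf qf; have qfin : qtot E V0 m k f \is a fin_num.
  by rewrite ge0_fin_numE ?qtot_ge0.
rewrite /successors /jump_prob; case: ifPn => q0; last first.
  by rewrite big_seq1; case: ifPn => // /asboolP.
rewrite -mulr_suml; have sq := sum_qrate mf.
(* The terms of a finite sum are finite, which lets [fine] commute with the sum. *)
have : all [pred x in fin_num] [seq qrate E V0 m k f i | i <- jump_targets f].
  by rewrite -[jump_targets f]filter_predT -sum_fin_num sq.
move/allP => allfin; rewrite big_seq sum_fine; last first.
  by move=> g gt; apply: allfin; exact: map_f.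
by rewrite -big_seq sq divff// gt_eqF.
Qed.

(** The increment [D + 2] covers both the [D] of a node step and the [2] of an edge step. *)
Lemma mass_successors (D : nat) f g :
  (forall x y, E x y -> ~~ E y x) ->
  (forall x (s : seq V), uniq s -> all (adj E x) s -> (size s <= D)%N) ->
  g \in successors f -> (mass g <= mass f + (D + 2)%:R%:E)%E.
Proof.
move=> Eonce deg; rewrite /successors; case: ifP => _; last first.
  by rewrite inE => /eqP ->; rewrite leeDl// lee_fin.
rewrite mem_filter mem_undup mem_cat => /andP[_ /orP[] /mapP[y _ ->]].
  apply: (le_trans (mass_node_step f Eonce (deg y))).
  by rewrite leeD2l// lee_fin ler_nat leq_addr.
apply: (le_trans (mass_edge_step y f)).
by rewrite leeD2l// lee_fin (ler_nat R 2) leq_addl.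
Qed.

End Mass.

(** * Linear growth of the rates of the particle system *)

Theorem theorem2p1 (R : realType) (V : countType) (E : rel V) (V0 : pred V)
  (m : V -> R) (k : V -> V -> R)
  (HEirr : forall x, ~~ E x x)
  (HEonce : forall x y, E x y -> ~~ E y x)
  (Hm : forall x, 0 < m x)
  (Hk : forall x y, 0 <= k x y)
  (Hk0 : forall x y, ~~ E x y -> k x y = 0)
  (Hdeg : exists D : nat, forall (x : V) (s : seq V),
            uniq s -> all (adj E x) s -> (size s <= D)%N)
  (HM : exists M : R, (forall x, (m x)^-1 <= M) /\ (forall x y, E x y -> k x y <= M))
  (f0 : state V) (Hf0 : F0 E f0)
  (d : measure_display) (Omega : measurableType d) (P : probability Omega R)
  (h : nat -> Omega -> state V) (xi : nat -> Omega -> \bar R)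
  (Hproc : IPS_jump_process P E V0 m k f0 h xi) :
  P [set w | (\sum_(0 <= n <oo) xi n.+1 w)%E = +oo%E] = 1%E.
Proof.
have [D deg] := Hdeg; have [M [mM kM]] := HM.
have [h0 mh mxi law] := Hproc.
(* The absolute value supplies the sign needed in [qtot_le]; [M] may be negative when there are no
   nodes. *)
have m0M x : (m x)^-1 <= `|M| by apply: le_trans (ler_norm M).
have k0M x y : E x y -> k x y <= `|M|.
  by move=> /kM/le_trans; apply; exact: ler_norm.
have mass0_lty : (mass R f0 < +oo)%E.
  by have [finx fine _] := Hf0; apply: lte_add_pinfty;
    exact: finite_support_esum_int.
have mass_ge0 (f : state V) : (0 <= mass R f)%E.
  by apply: adde_ge0; apply: esum_ge0 => ? _; exact: abs_int_ge0.
have mass0_fin : mass R f0 \is a fin_num by rewrite ge0_fin_numE.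
pose L := fine (mass R f0).
have L0 : 0 <= L by exact: fine_ge0.
pose level n (f : state V) := (mass R f <= (L + n%:R * (D + 2)%:R)%:E)%E.
have qtot_level n f : level n f ->
    (qtot E V0 m k f <= (`|M| * (L + n%:R * (D + 2)%:R))%:E)%E.
  move=> lf; apply: (le_trans (qtot_le V0 f (normr_ge0 M) m0M k0M)).
  by rewrite EFinM; apply: lee_wpmul2l.
(* The constant comes from [L + n (D + 2) <= (L + (D + 2)) (n + 1)]. *)
apply: (@linear_rate_nonexplosive R d Omega P (state V)
  (fun f => fine (qtot E V0 m k f)) (jump_prob E V0 m k) f0 h xi mh mxi law
  (successors E V0 m k) level (`|M| * (L + (D + 2)%:R))).
- by move=> f; exact/fine_ge0/qtot_ge0.
- by move=> f g; exact: jump_prob_ge0.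
- by rewrite /level mul0r addr0 fineK.
- move=> n f g lf /(mass_successors HEonce deg)/le_trans; apply.
  by rewrite -natr1 mulrDl mul1r addrA EFinD leeD2r.
- by move=> n f _; exact: successors_uniq.
- move=> n f lf; apply: sum_jump_prob => //; first exact: le_lt_trans lf (ltry _).
  exact: le_lt_trans (qtot_level n f lf) (ltry _).
- by rewrite mulr_ge0// addr_ge0.
- move=> n f /qtot_level qle.
  have qfin : qtot E V0 m k f \is a fin_num.
    by rewrite ge0_fin_numE ?qtot_ge0// (le_lt_trans qle)// ltry.
  rewrite -lee_fin fineK//; apply: (le_trans qle); rewrite lee_fin -mulrA.
  rewrite ler_wpM2l// mulrDl lerD// ?ler_peMr// ?ler1n//.
  by rewrite mulrC ler_wpM2l// ler_nat.
Qed.
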